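(* Let $n\in\mathbb N$ and let $D$ be a central subset of $S_0$. Let $F$ be a finite nonempty set of $S_0$-preserving homomorphisms from $S_n$ into $S_0$. Then $\{w\in S_n:\ \nu(w)\in D \text{ for all } \nu\in F\}$ is central in $S_n$.
   Context: $\mathbb A$ is a fixed nonempty finite alphabet, $S_0=\mathbb A^+$ the free semigroup of nonempty words over $\mathbb A$, and $S_n$ the set of nonempty words over $\mathbb A\cup\{v_1,\dots,v_n\}$ (distinct variables not in $\mathbb A$) in which each $v_i$ occurs, a semigroup under concatenation. A homomorphism $\nu:S_n\to S_0$ is $S_0$-preserving if $\nu(uw)=u\nu(w)$ and $\nu(wu)=\nu(w)u$ for all $u\in S_0,w\in S_n$. For a discrete semigroup $X$, $\beta X$ is its Stone–Čech compactification (ultrafilters) with the extended operation ($A\in pq$ iff $\{x:x^{-1}A\in q\}\in p$), a compact right topological semigroup with smallest two-sided ideal $K(\beta X)$; a subset $D\subseteq X$ is central if $D\in p$ for some idempotent $p\in K(\beta X)$. *)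

(* Defs.v *)
From HB Require Import structures.
From mathcomp Require Import all_boot.
From mathcomp Require Import boolp classical_sets functions cardinality filter.

Set Implicit Arguments.
Unset Strict Implicit.
Unset Printing Implicit Defensive.

Local Open Scope classical_set_scope.
Local Open Scope group_scope.

(* The topology of the Stone-Cech compactification of a discrete space plays no
   role in the notion of central set, so only its points and (below) its
   semigroup operation are introduced. *)
Record beta (X : Type) := Beta {
  beta_sets : set_system X;
  beta_ultra : UltraFilter beta_sets
}.

HB.instance Definition _ (X : Type) := gen_eqMixin (beta X).
HB.instance Definition _ (X : Type) := gen_choiceMixin (beta X).

Lemma beta_ext (X : Type) (p q : beta X) :
  (forall B : set X, beta_sets p B <-> beta_sets q B) -> p = q.
Proof.
case: p q => [p pU] [q qU] /= pq.
have e : p = q by apply/funext => B; exact/propext.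
by rewrite -{}e in qU *; congr Beta; exact: Prop_irrelevance.
Qed.

Lemma ultra_of_compl (X : Type) (F : set_system X) :
  ProperFilter F -> (forall B, F B \/ F (~` B)) -> UltraFilter F.
Proof.
move=> FF Fcompl; split=> // G GF FG; apply/seteqP; split=> // B GB.
have [//|/FG GnB] := Fcompl B.
exfalso; apply: (@filter_not_empty _ G).
by rewrite -(setICr B); exact: filterI.
Qed.

(* With the order of the factors chosen here, p |-> p * q is the continuous
   translation: [beta X] is right topological. *)
Definition beta_mul_sets (X : magmaType) (p q : set_system X) : set_system X :=
  [set B | p [set x | q [set y | B (x * y)]]].

Lemma beta_mul_ultra (X : magmaType) (p q : beta X) :
  UltraFilter (beta_mul_sets (beta_sets p) (beta_sets q)).
Proof.
case: p q => [p pU] [q qU] /=; rewrite /beta_mul_sets; apply: ultra_of_compl.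
  split.
    rewrite /= (_ : [set x | _] = set0); first exact: filter_not_empty.
    by rewrite -subset0 => x; exact: filter_not_empty.
  split.
  - by rewrite /=; apply: filterS filterT => x _; exact: filterT.
  - move=> B C /= pB pC; apply: filterS (filterI pB pC) => x [qB qC].
    exact: filterI qB qC.
  - move=> B C BC /=; apply: filterS => x; apply: filterS => y; exact: BC.
move=> B; have [pB|pB] := in_ultra_setVsetC [set x | q [set y | B (x * y)]] pU.
  by left.
right; apply: filterS pB => x nqB.
by have [/nqB|] := in_ultra_setVsetC [set y | B (x * y)] qU.
Qed.

Definition beta_mul (X : magmaType) (p q : beta X) : beta X :=
  Beta (beta_mul_ultra p q).

Lemma beta_mulA (X : semigroupType) : associative (@beta_mul X).
Proof.
move=> p q r; apply: beta_ext => B; rewrite /= /beta_mul_sets /=.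
suff -> : [set x | beta_sets q [set y | beta_sets r [set z | B (x * (y * z))]]] =
          [set x | beta_sets q [set y | beta_sets r [set z | B (x * y * z)]]] by [].
apply/funext => x; congr (beta_sets q _); apply/funext => y; congr (beta_sets r _).
by apply/funext => z; rewrite /mkset mulgA.
Qed.

HB.instance Definition _ (X : semigroupType) :=
  isSemigroup.Build (beta X) (@beta_mulA X).

Definition two_sided_ideal (T : semigroupType) (I : set T) : Prop :=
  I !=set0 /\ forall x y : T, I y -> I (x * y) /\ I (y * x).

(* [smallest C G] is the intersection of all sets in [C] that contain [G]; in a
   compact right topological semigroup, such as [beta X] for [X] nonempty, it is
   itself a two-sided ideal, the least one. *)
Definition smallest_ideal (T : semigroupType) : set T :=
  smallest (@two_sided_ideal T) set0.

Definition idempotent_elt (T : semigroupType) (p : T) : Prop := p * p = p.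

Definition central (X : semigroupType) (D : set X) : Prop :=
  exists p : beta X, [/\ smallest_ideal p, idempotent_elt p & beta_sets p D].

Section Words.
Variable A : finType.

Record word := Word { word_seq :> seq A; _ : word_seq != [::] }.

HB.instance Definition _ := [isSub for word_seq].
HB.instance Definition _ := [Choice of word by <:].

Lemma word_mul_subproof (u w : word) : (u : seq A) ++ w != [::].
Proof. by case: u => -[]. Qed.

Definition word_mul (u w : word) : word := Word (word_mul_subproof u w).

Lemma word_mulA : associative word_mul.
Proof. by move=> u v w; apply: val_inj; rewrite /= catA. Qed.

HB.instance Definition _ := isSemigroup.Build word word_mulA.

(* The letter [inl a] is the constant a and [inr i] is the variable v_(i+1). *)
Definition all_vars (n : nat) (s : seq (A + 'I_n)) : bool :=
  (s != [::]) && [forall i : 'I_n, inr i \in s].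

Record varword (n : nat) :=
  VarWord { varword_seq :> seq (A + 'I_n); _ : all_vars varword_seq }.

HB.instance Definition _ (n : nat) := [isSub for @varword_seq n].
HB.instance Definition _ (n : nat) := [Choice of varword n by <:].

Variable n : nat.

Lemma all_vars_cat (s1 s2 t : seq (A + 'I_n)) :
  all_vars t -> all_vars (s1 ++ t ++ s2).
Proof.
case/andP=> t0 /forallP tv; apply/andP; split.
  by case: s1 t t0 {tv} => [|? ?] [].
by apply/forallP => i; rewrite !mem_cat tv orbT.
Qed.

Lemma all_vars_catl (s t : seq (A + 'I_n)) : all_vars t -> all_vars (s ++ t).
Proof. by move=> /(all_vars_cat s [::]); rewrite cats0. Qed.

Lemma all_vars_catr (s t : seq (A + 'I_n)) : all_vars t -> all_vars (t ++ s).
Proof. exact: (@all_vars_cat [::]). Qed.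

Definition varword_mul (w w' : varword n) : varword n :=
  VarWord (all_vars_catr w' (valP w)).

Lemma varword_mulA : associative varword_mul.
Proof. by move=> u v w; apply: val_inj; rewrite /= catA. Qed.

HB.instance Definition _ := isSemigroup.Build (varword n) varword_mulA.

Definition const_seq (u : word) : seq (A + 'I_n) := map inl u.

(* The concatenations u w and w u of a constant word u and a word w in which
   all the variables occur. *)
Definition lcat (u : word) (w : varword n) : varword n :=
  VarWord (all_vars_catl (const_seq u) (valP w)).
Definition rcat (w : varword n) (u : word) : varword n :=
  VarWord (all_vars_catr (const_seq u) (valP w)).

Definition word_preserving (nu : varword n -> word) : Prop :=
  forall (u : word) (w : varword n),
    nu (lcat u w) = u * nu w /\ nu (rcat w u) = nu w * u.

End Words.

(* Main.v *)
(* The words in which either no variable or every variable occurs form a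
   semigroup in which S_n is an ideal and of which each nu, extended by the
   identity on S_0, is a retraction onto S_0. Given a minimal idempotent p of
   beta S_0 containing D, there is below p a minimal idempotent q of the
   compactification of this semigroup, and q lies in beta S_n. Then nu(q) is an
   idempotent below nu(p) = p, so nu(q) = p by minimality, and the preimages of
   D under the finitely many nu all belong to q. Instead of the larger
   semigroup, the actions of beta S_0 on both sides of beta S_n are used: q is
   p r for a minimal idempotent r of the closed left ideal of those x with
   x p = x. *)
Require Import Defs.
From mathcomp Require Import all_boot.
From mathcomp Require Import boolp classical_sets functions cardinality filter.

Set Implicit Arguments.
Unset Strict Implicit.
Unset Printing Implicit Defensive.

Local Open Scope classical_set_scope.

(** * Closed sets, continuous maps and compactness in [beta X] *)

Section BetaTopology.

(* The sets [p | B in p] form a basis of clopen sets of [beta X]; closed sets and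
   continuous maps are expressed with this basis. *)
Definition beta_closed {X : Type} (C : set (beta X)) : Prop :=
  forall p, (forall B, beta_sets p B -> exists2 q, C q & beta_sets q B) -> C p.

Definition beta_continuous {X Y : Type} (f : beta X -> beta Y) : Prop :=
  forall B, exists B', forall p, beta_sets (f p) B <-> beta_sets p B'.

#[local] Instance beta_sets_ultra (X : Type) (p : beta X) :
  UltraFilter (beta_sets p) := beta_ultra p.

Lemma beta_setsC {X : Type} (p : beta X) (B : set X) :
  ~ beta_sets p B -> beta_sets p (~` B).
Proof. by have [|//] := in_ultra_setVsetC B (beta_ultra p). Qed.

Lemma beta_setsNC {X : Type} (p : beta X) (B : set X) :
  beta_sets p B -> beta_sets p (~` B) -> False.
Proof.
move=> pB pnB; apply: (@filter_not_empty _ (beta_sets p)).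
by rewrite -(setICr B); exact: filterI.
Qed.

Lemma beta_sub_eq {X : Type} (p q : beta X) :
  beta_sets p `<=` beta_sets q -> p = q.
Proof.
move=> pq; apply: beta_ext => B.
by rewrite (max_filter (F := beta_sets p) _ pq).
Qed.

Lemma beta_refine {X : Type} {G : set_system X} :
  ProperFilter G -> exists p : beta X, G `<=` beta_sets p.
Proof.
by move=> /ultraFilterLemma[H [HU GH]]; exists (Beta HU).
Qed.

Lemma beta_closed_mem {X : Type} {C : set (beta X)} {p : beta X} :
  beta_closed C ->
  (forall B, (forall q, C q -> beta_sets q B) -> beta_sets p B) -> C p.
Proof.
move=> Ccl Cp; apply: Ccl => B pB; apply: contrapT => nC.
apply: (beta_setsNC pB); apply: Cp => q Cq; apply: beta_setsC => qB.
by apply: nC; exists q.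
Qed.

Lemma beta_closed_bigcap {X : Type} (F : set (set (beta X))) :
  (forall C, F C -> beta_closed C) -> beta_closed (\bigcap_(C in F) C).
Proof.
move=> Fcl p Fp C FC; apply: Fcl (FC) _ _ => B /Fp[q Fq qB].
by exists q => //; exact: Fq.
Qed.

Lemma beta_closedI {X : Type} (C1 C2 : set (beta X)) :
  beta_closed C1 -> beta_closed C2 -> beta_closed (C1 `&` C2).
Proof.
move=> C1cl C2cl p Cp; split.
  by apply: C1cl => B /Cp[q [C1q _] qB]; exists q.
by apply: C2cl => B /Cp[q [_ C2q] qB]; exists q.
Qed.

Lemma beta_closedT {X : Type} : beta_closed [set: beta X].
Proof. by []. Qed.

Lemma beta_continuous_id {X : Type} : beta_continuous (@id (beta X)).
Proof. by move=> B; exists B. Qed.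

Lemma beta_continuous_cst {X Y : Type} (y : beta Y) :
  beta_continuous (fun _ : beta X => y).
Proof.
move=> B; have [yB|yB] := pselect (beta_sets y B).
  by exists setT => p; split=> // _; exact: filterT.
by exists set0 => p; split=> // /filter_not_empty.
Qed.

(** This is the Hausdorff property: a set [B] that separates [f p] from [g p] pulls back to a basic
    neighbourhood of [p] on which [f] and [g] differ. *)
Lemma beta_closed_eq {X Y : Type} (f g : beta X -> beta Y) :
  beta_continuous f -> beta_continuous g -> beta_closed [set x | f x = g x].
Proof.
move=> fc gc p Ep; apply: beta_sub_eq => B fB; apply: contrapT => /beta_setsC gB.
have [B1 fB1] := fc B; have [B2 gB2] := gc (~` B).
have pB12 : beta_sets p (B1 `&` B2) by apply: filterI; [exact/fB1|exact/gB2].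
have [q /= fgq qB12] := Ep _ pB12.
apply: (@beta_setsNC _ (f q) B).
  by apply/fB1; exact: filterS qB12 => x [].
by rewrite fgq; apply/gB2; exact: filterS qB12 => x [].
Qed.

(** Compactness argument: for [y] in the closure of the image, [G] collects the sets common to all
    [q] in [C] with [f q] in a given basic neighbourhood of [y]. An ultrafilter refining [G] lies in
    [C] and is sent to [y]. *)
Lemma beta_closed_image {X Y : Type} (f : beta X -> beta Y) (C : set (beta X)) :
  beta_continuous f -> beta_closed C -> beta_closed (f @` C).
Proof.
move=> fc Ccl y Cy.
pose G := [set E | exists2 B, beta_sets y B &
  forall q, C q -> beta_sets (f q) B -> beta_sets q E].
have GP : ProperFilter G.
  split; first by case=> B /Cy[_ [q Cq <-] fqB] /(_ q Cq fqB) /filter_not_empty.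
  split.
  - by exists setT => [|q _ _]; exact: filterT.
  - move=> E1 E2 [B1 yB1 h1] [B2 yB2 h2]; exists (B1 `&` B2); first exact: filterI.
    move=> q Cq fqB; apply: filterI.
      by apply: h1 => //; exact: filterS fqB => x [].
    by apply: h2 => //; exact: filterS fqB => x [].
  - move=> E1 E2 E12 [B yB h]; exists B => // q Cq fqB.
    exact: filterS E12 (h q Cq fqB).
have [p Gp] := beta_refine GP.
exists p.
  apply: (beta_closed_mem Ccl) => B CB; apply: Gp.
  by exists setT => [|q Cq _]; [exact: filterT|exact: CB].
apply/esym/beta_sub_eq => B yB; have [B' fB'] := fc B.
by apply/fB'; apply: Gp; exists B => // q _ /fB'.
Qed.

(** The sets common to all members of a given [C] form a filter that grows as [C] shrinks, so along
    a chain their union [G] is a filter; an ultrafilter refining it lies in every [C]. *)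
Lemma beta_chain_compact {X : Type} (F : set (set (beta X))) :
  F !=set0 -> total_on F subset ->
  (forall C, F C -> beta_closed C /\ C !=set0) -> \bigcap_(C in F) C !=set0.
Proof.
move=> [C0 FC0] Ftot Fcl.
pose G := [set B | exists2 C, F C & forall q, C q -> beta_sets q B].
have GP : ProperFilter G.
  split.
    case=> C FC CB; have [_ [q /CB]] := Fcl C FC.
    exact: filter_not_empty.
  split.
  - by exists C0 => // q _; exact: filterT.
  - move=> B1 B2 [C1 FC1 CB1] [C2 FC2 CB2].
    have [C12|C21] := Ftot _ _ FC1 FC2.
      exists C1 => // q Cq; apply: filterI; [exact: CB1|].
      by apply: CB2; exact: C12.
    exists C2 => // q Cq; apply: filterI; [|exact: CB2].
    by apply: CB1; exact: C21.
  - move=> B1 B2 B12 [C FC CB]; exists C => // q Cq.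
    exact: filterS B12 (CB q Cq).
have [p Gp] := beta_refine GP.
exists p => C FC; have [Ccl _] := Fcl C FC.
by apply: (beta_closed_mem Ccl) => B CB; apply: Gp; exists C.
Qed.

Lemma exists_minimal_closed {X : Type} (P : set (set (beta X))) (C0 : set (beta X)) :
  (forall C, P C -> beta_closed C) ->
  (forall F, F `<=` P -> P (\bigcap_(C in F) C)) ->
  P C0 -> C0 !=set0 ->
  exists C, [/\ C `<=` C0, P C, C !=set0 &
    forall C', P C' -> C' !=set0 -> C' `<=` C -> C' = C].
Proof.
move=> Pcl Pcap PC0 C0n.
(* Zorn's lemma is applied to unions of chains, so the sets sought are represented by what they
   remove from [C0]: a maximal [U] gives a minimal set. *)
pose Q := [set U : set (beta X) | P (C0 `\` U) /\ C0 `\` U !=set0].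
have [|U [[PU Un] Umax]] := @Zorn_bigcup _ Q.
  (* Adjoining [set0] puts [C0] itself into [F'], which handles the empty chain. *)
  move=> F FQ Ftot; pose F' := [set C0 `\` V | V in set0 |` F].
  have F'Q C : F' C -> P C /\ C !=set0.
    by move=> [V FV <-]; case: FV => [->|/FQ//]; rewrite setD0.
  have -> : Q (\bigcup_(V in F) V) =
      (P (\bigcap_(C in F') C) /\ \bigcap_(C in F') C !=set0).
    suff -> : \bigcap_(C in F') C = C0 `\` \bigcup_(V in F) V by [].
    apply/seteqP; split=> x.
      move=> F'x; split; first by rewrite -(setD0 C0); apply: F'x; exists set0 => //; left.
      move=> [V FV Vx]; have [|_ /(_ Vx)//] := F'x (C0 `\` V).
      by exists V => //; right.
    move=> [C0x nFx] _ [V [->|FV] <-]; first by rewrite setD0.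
    by split=> // Vx; apply: nFx; exists V.
  split; first by apply: Pcap => C /F'Q[].
  apply: beta_chain_compact.
  - by exists (C0 `\` set0); exists set0 => //; left.
  - move=> _ _ [V1 FV1 <-] [V2 FV2 <-].
    have [V12|V21] : V1 `<=` V2 \/ V2 `<=` V1.
      case: FV1 FV2 => [->|FV1] [->|FV2]; [by left|by left|by right|exact: Ftot].
    + by right; exact: setDS.
    + by left; exact: setDS.
  - by move=> C /F'Q[PC Cn]; split=> //; exact: Pcl.
exists (C0 `\` U); split=> // C' PC' C'n C'U; apply: contrapT => C'neq.
have C'E : C0 `\` (C0 `\` C') = C'.
  by rewrite setDD setIidr// => x /C'U[].
apply: (Umax (U `|` (C0 `\` C'))); last first.
  suff e : C0 `\` (U `|` (C0 `\` C')) = C' by split; rewrite e.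
  rewrite setDUr C'E; apply/seteqP; split=> x; first by case.
  by move=> C'x; split=> //; exact: C'U.
split; first by move=> x; left.
move=> UU; apply: C'neq; apply/seteqP; split=> // x [C0x nUx].
by apply: contrapT => nC'x; apply: nUx; apply: UU; right.
Qed.

End BetaTopology.

(** * Minimal left ideals and idempotents of [beta X] *)

Section BetaSemigroup.
Local Open Scope group_scope.
Variable X : semigroupType.
Implicit Types (p q r x y : beta X) (C : set (beta X)).

Lemma beta_mulr_continuous (a : beta X) : beta_continuous (fun x => x * a).
Proof. by move=> B; exists [set x | beta_sets a [set y | B (x * y)]]. Qed.

(* Equivalently, [p] lies in a minimal left ideal. *)
Definition left_minimal p : Prop := forall x, exists y, y * x * p = p.

(** From [y * (x * a) * p = p] follows [(a * y) * x * (a * p) = a * p]; for [p * a], multiply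
    [y * x * p = p] by [a] on the right. *)
Lemma left_minimal_ideal p : left_minimal p -> two_sided_ideal left_minimal.
Proof.
move=> pmin; split; first by exists p.
move=> a {pmin}p pmin; split=> x.
  by have [y yp] := pmin (x * a); exists (a * y); rewrite -[in RHS]yp !mulgA.
by have [y yp] := pmin x; exists y; rewrite mulgA yp.
Qed.

Lemma left_minimal_smallest_ideal p : left_minimal p -> smallest_ideal p.
Proof.
move=> pmin I [[[x Ix] Iideal] _]; have [y <-] := pmin x.
by apply: (Iideal _ _ _).2; apply: (Iideal _ _ _).1.
Qed.

Definition closed_left_ideal C : Prop :=
  beta_closed C /\ forall x y, C y -> C (x * y).

Definition closed_subsemigroup C : Prop :=
  beta_closed C /\ forall x y, C x -> C y -> C (x * y).

(** The Ellis-Numakura argument. For [a] in a minimal closed subsemigroup [C'], minimality gives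
    [C' a = C'], so the [x] in [C'] with [x * a = a] form a nonempty closed subsemigroup; this is
    again all of [C'] and contains [a]. *)
Lemma closed_subsemigroup_idempotent C :
  closed_subsemigroup C -> C !=set0 -> exists2 r, C r & idempotent_elt r.
Proof.
move=> Csub Cn.
have [||C' [C'C [C'cl C'M] [a C'a] C'min]] :=
  @exists_minimal_closed _ closed_subsemigroup C _ _ Csub Cn.
- by move=> ? [].
- move=> F FP; split; first by apply: beta_closed_bigcap => E /FP[].
  by move=> x y Fx Fy E FE; apply: (FP _ FE).2; [exact: Fx|exact: Fy].
have C'aE : (fun x => x * a) @` C' = C'.
  apply: C'min.
  - split; first exact: beta_closed_image (beta_mulr_continuous a) C'cl.
    move=> _ _ [x C'x <-] [y C'y <-]; exists (x * a * y); last by rewrite mulgA.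
    by apply: (C'M) C'y; exact: C'M.
  - by exists (a * a); exists a.
  - by move=> _ [x C'x <-]; exact: C'M.
have fixE : C' `&` [set x | x * a = a] = C'.
  apply: C'min.
  - split.
      apply: beta_closedI => //; apply: beta_closed_eq.
        exact: beta_mulr_continuous.
      exact: beta_continuous_cst.
    move=> x y [C'x xa] [C'y ya]; split; first exact: C'M.
    by rewrite /= -mulgA ya.
  - by have := C'a; rewrite -{1}C'aE => -[x C'x xa]; exists x.
  - by move=> x [].
exists a; first exact: C'C.
by have := C'a; rewrite -{1}fixE => -[].
Qed.

Lemma closed_left_ideal_minimal_idempotent C :
  closed_left_ideal C -> C !=set0 ->
  exists r, [/\ C r, left_minimal r & idempotent_elt r].
Proof.
move=> Cid Cn.
have [||L [LC [Lcl Lid] Ln Lmin]] :=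
  @exists_minimal_closed _ closed_left_ideal C _ _ Cid Cn.
- by move=> ? [].
- move=> F FP; split; first by apply: beta_closed_bigcap => E /FP[].
  by move=> x y Fy E FE; apply: (FP _ FE).2; exact: Fy.
have [|r Lr rr] := @closed_subsemigroup_idempotent L _ Ln.
  by split=> // x y _; exact: Lid.
exists r; split=> //; first exact: LC.
move=> x.
(* The left ideal generated by [x * r] is closed, as a continuous image of the whole space, and lies
   in [L], hence equals [L]. *)
suff : [set y * (x * r) | y in setT] r by move=> [y _ yr]; exists y; rewrite -mulgA.
rewrite (Lmin [set y * (x * r) | y in setT]) //.
- split.
    exact: beta_closed_image (beta_mulr_continuous _) (@beta_closedT _).
  by move=> z _ [y _ <-]; exists (z * y) => //; rewrite -mulgA.
- by exists (x * (x * r)); exists x.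
- by move=> _ [y _ <-]; apply/Lid/Lid.
Qed.

(** The left minimal elements form a two-sided ideal as soon as one exists, and a minimal closed
    left ideal provides one. *)
Lemma smallest_ideal_left_minimal p : smallest_ideal p -> left_minimal p.
Proof.
move=> pK.
have [||r [_ rmin _]] := @closed_left_ideal_minimal_idempotent setT.
- by split=> //; exact: beta_closedT.
- by exists p.
by apply: pK; split; [exact: left_minimal_ideal rmin|exact: sub0set].
Qed.

(** Minimality yields [y] with [p = y * e * p = y * e], whence
    [e = p * e = y * e * e = y * e = p]. *)
Lemma left_minimal_idempotent_min p e : left_minimal p ->
  idempotent_elt e -> p * e = e -> e * p = e -> e = p.
Proof.
move=> pmin ee pe ep; have [y] := pmin e.
by rewrite -mulgA ep => ye; rewrite -pe -{1}ye -mulgA ee.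
Qed.

End BetaSemigroup.

(** * Extension of maps and binary operations to ultrafilters *)

Section BetaLift.

Lemma fmap_ultra {X Y : Type} (f : X -> Y) (p : beta X) :
  UltraFilter (fmap f (beta_sets p)).
Proof.
have pU := beta_ultra p; apply: ultra_of_compl => B.
exact: (in_ultra_setVsetC (f @^-1` B)).
Qed.

Definition beta_map {X Y : Type} (f : X -> Y) (p : beta X) : beta Y :=
  Beta (fmap_ultra f p).

(** The product formula with factors from different sets, so that [lcat] and [rcat] extend to
    actions of [beta (word A)] on [beta (varword A n)]. *)
Definition beta_map2_sets {X Y Z : Type} (f : X -> Y -> Z)
    (p : set_system X) (q : set_system Y) : set_system Z :=
  [set B | p [set x | q [set y | B (f x y)]]].

Lemma beta_map2_ultra {X Y Z : Type} (f : X -> Y -> Z) (p : beta X) (q : beta Y) :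
  UltraFilter (beta_map2_sets f (beta_sets p) (beta_sets q)).
Proof.
case: p q => [p pU] [q qU]; rewrite /beta_map2_sets /=; apply: ultra_of_compl.
  split.
    rewrite /= (_ : [set x | _] = set0); first exact: filter_not_empty.
    by rewrite -subset0 => x; exact: filter_not_empty.
  split.
  - by rewrite /=; apply: filterS filterT => x _; exact: filterT.
  - move=> B C /= pB pC; apply: filterS (filterI pB pC) => x [qB qC].
    exact: filterI qB qC.
  - by move=> B C BC /=; apply: filterS => x; apply: filterS => y; exact: BC.
move=> B; have [pB|pB] := in_ultra_setVsetC [set x | q [set y | B (f x y)]] pU.
  by left.
right; apply: filterS pB => x nqB.
by have [/nqB|] := in_ultra_setVsetC [set y | B (f x y)] qU.
Qed.

Definition beta_map2 {X Y Z : Type} (f : X -> Y -> Z) (p : beta X) (q : beta Y) :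
  beta Z := Beta (beta_map2_ultra f p q).

Lemma beta_map2_continuous {X Y Z : Type} (f : X -> Y -> Z) (q : beta Y) :
  beta_continuous (fun p => beta_map2 f p q).
Proof. by move=> B; exists [set x | beta_sets q [set y | B (f x y)]]. Qed.

Lemma beta_mulE (X : semigroupType) (p q : beta X) :
  (p * q)%g = beta_map2 (fun x y => (x * y)%g) p q.
Proof. exact: beta_ext. Qed.

(** Associativity with mixed types: one statement covers every law relating the two actions and the
    two products. *)
Lemma beta_map2A {X Y Z XY YZ W : Type} (f : X -> Y -> XY) (g : XY -> Z -> W)
    (h : Y -> Z -> YZ) (k : X -> YZ -> W) :
  (forall x y z, g (f x y) z = k x (h y z)) ->
  forall p q r, beta_map2 g (beta_map2 f p q) r = beta_map2 k p (beta_map2 h q r).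
Proof.
move=> fghk p q r; apply: beta_ext => B; rewrite /= /beta_map2_sets /=.
by under eq_set do under eq_set do under eq_set do rewrite fghk.
Qed.

Lemma beta_map_map2 {X Y Z X' Y' Z' : Type} (f : X -> Y -> Z)
    (f' : X' -> Y' -> Z') (h : Z -> Z') (h1 : X -> X') (h2 : Y -> Y') :
  (forall x y, h (f x y) = f' (h1 x) (h2 y)) ->
  forall p q,
    beta_map h (beta_map2 f p q) = beta_map2 f' (beta_map h1 p) (beta_map h2 q).
Proof.
move=> hf p q; apply: beta_ext => B.
rewrite /= /fmap /= /beta_map2_sets /= /preimage /=.
by under eq_set do under eq_set do rewrite hf.
Qed.

Lemma beta_map_id {X : Type} (p : beta X) : beta_map id p = p.
Proof. exact: beta_ext. Qed.

Lemma beta_map_mul {X Y : semigroupType} (f : {multiplicative X -> Y}) p q :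
  beta_map f (p * q)%g = (beta_map f p * beta_map f q)%g.
Proof. by rewrite !beta_mulE; apply: beta_map_map2 => x y; exact: gmulfM. Qed.

End BetaLift.

(** * Finite intersections in a filter, and the lift of minimal idempotents from S_0 to S_n *)

Lemma filter_finite_forall {X I : Type} (G : set_system X) (F : set I)
    (P : I -> set X) : Filter G -> finite_set F ->
  (forall i, F i -> G (P i)) -> G [set x | forall i, F i -> P i x].
Proof.
move=> GF /(@finite_seqP {classic I})[s ->] GP.
rewrite (_ : [set x | _] = [set x | {in s, forall i, P i x}])//.
elim: s GP => [|i s IHs] GP; first by apply: filterS filterT.
have Gi : G (P i) by apply: GP; rewrite /= mem_head.
have Gs : G [set x | {in s, forall i, P i x}].
  by apply: IHs => j js; apply: GP; rewrite /= in_cons orbC js.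
apply: filterS (filterI Gi Gs) => x [Pi Ps] j.
by rewrite in_cons => /predU1P[->//|]; exact: Ps.
Qed.

Lemma all_vars_enum (A : finType) (n : nat) :
  (0 < n)%N -> all_vars (map (@inr A 'I_n) (enum 'I_n)).
Proof.
move=> n_gt0; apply/andP; split.
  by rewrite -size_eq0 size_map size_enum_ord -lt0n.
by apply/forallP => i; rewrite map_f// mem_enum.
Qed.

Lemma exists_minimal_idempotent_lift {A : finType} {n : nat} (n_gt0 : (0 < n)%N)
    (p : beta (word A)) : smallest_ideal p -> idempotent_elt p ->
  exists q : beta (varword A n), [/\ smallest_ideal q, idempotent_elt q &
    forall nu : {multiplicative varword A n -> word A}, word_preserving nu ->
      beta_map nu q = p].
Proof.
move=> /smallest_ideal_left_minimal pmin pp.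
pose lact (q : beta (varword A n)) := beta_map2 (@lcat A n) p q.
pose ract (q : beta (varword A n)) := beta_map2 (@rcat A n) q p.
(* These laws are associativity in the semigroup of all words involved, each reduced to
   associativity of concatenation; idempotence of [p] makes both actions projections. *)
have ract_mul x y : ract (x * y)%g = (x * ract y)%g.
  rewrite /ract !beta_mulE; apply: beta_map2A => u v w.
  by apply: val_inj; rewrite /= -catA.
have lact_mul x y : lact (x * y)%g = (lact x * y)%g.
  rewrite /lact !beta_mulE; apply/esym/beta_map2A => u v w.
  by apply: val_inj; rewrite /= -catA.
have lract_mul x y : (ract x * y = x * lact y)%g.
  rewrite /lact /ract !beta_mulE; apply: beta_map2A => u v w.
  by apply: val_inj; rewrite /= -catA.
have ract_lact x : ract (lact x) = lact (ract x).
  apply: beta_map2A => u v w.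
  by apply: val_inj; rewrite /= -catA.
have ractK x : ract (ract x) = ract x.
  rewrite /ract -[in RHS]pp beta_mulE; apply: beta_map2A => u v w.
  by apply: val_inj; rewrite /= /const_seq map_cat catA.
have lactK x : lact (lact x) = lact x.
  rewrite /lact -[in RHS]pp beta_mulE; apply/esym/beta_map2A => u v w.
  by apply: val_inj; rewrite /= /const_seq map_cat catA.
pose L := [set x | ract x = x].
have [||r [rL rmin rr]] := @closed_left_ideal_minimal_idempotent _ L.
- split.
    apply: beta_closed_eq; last exact: beta_continuous_id.
    exact: beta_map2_continuous.
  by move=> x y; rewrite /L /= ract_mul => ->.
(* The principal ultrafilter at the word v_1...v_n, multiplied by [p] on the right, is a point of
   [L]. *)
- exists (ract (Beta (principal_filter_ultra (VarWord (all_vars_enum A n_gt0))))).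
  exact: ractK.
(* In product notation: (p r)(p r) = p (r p) r = p r r = p r. *)
have lrlr : (lact r * lact r)%g = lact r by rewrite -lract_mul ract_lact rL -lact_mul rr.
exists (lact r); split=> //.
  apply: left_minimal_smallest_ideal.
  (* Since p r = (p r) r, the element [lact r] is a left multiple of the left minimal [r]. *)
  rewrite -{1}rr lact_mul.
  by apply: ((left_minimal_ideal _).2 _ _ _).1 => //; exact: rmin.
move=> nu nu_pres.
have nul x : beta_map nu (lact x) = (p * beta_map nu x)%g.
  rewrite beta_mulE -[in RHS](beta_map_id p); apply: beta_map_map2 => u v.
  by have [->] := nu_pres u v.
have nur x : beta_map nu (ract x) = (beta_map nu x * p)%g.
  rewrite beta_mulE -[in RHS](beta_map_id p); apply: beta_map_map2 => u v.
  by have [_ ->] := nu_pres v u.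
(* With q = p r one has p q = q = q p, so the image of q is an idempotent fixed by [p] on both
   sides. *)
apply: left_minimal_idempotent_min => //.
- by rewrite /idempotent_elt -beta_map_mul lrlr.
- by rewrite -nul lactK.
- by rewrite -nur ract_lact rL.
Qed.

Theorem theorem5p2 (A : finType) (A_nonempty : (0 < #|A|)%N)
    (n : nat) (n_gt0 : (0 < n)%N)
    (D : set (word A)) (D_central : central D)
    (F : set {multiplicative varword A n -> word A})
    (F_finite : finite_set F) (F_nonempty : F !=set0)
    (F_preserving : forall nu, F nu -> word_preserving nu) :
  central [set w : varword A n | forall nu, F nu -> D (nu w)].
Proof.
have [p [pK pp pD]] := D_central.
have [q [qK qq nuq]] := exists_minimal_idempotent_lift n_gt0 pK pp.
exists q; split=> //; have qU := beta_ultra q.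
apply: filter_finite_forall F_finite _ => nu /F_preserving/nuq nuqp.
by have := pD; rewrite -nuqp.
Qed.
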